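(* Let $(S,s)$ be an irretractable finite commutative non-degenerate solution. Then $(S,s)$ is isomorphic to $(\mathcal{G}(S,s),s_{\mathcal{G}(S,s)})$, where, for a group $G$, $s_G:G\times G\to G\times G$ is the map $s_G(g,h)=(g,g^{-1}h)$.
   Context: A solution (set-theoretic solution of the Pentagon Equation) is a pair $(S,s)$ with $S$ a non-empty set and $s:S\times S\to S\times S$ a map such that $s_{23}s_{13}s_{12}=s_{12}s_{23}$ as maps $S^3\to S^3$, where $s_{12}=s\times \mathrm{id}$, $s_{23}=\mathrm{id}\times s$, $s_{13}=(\tau\times \mathrm{id})(\mathrm{id}\times s)(\tau\times \mathrm{id})$ and $\tau(x,y)=(y,x)$. Writing $s(x,y)=(x\cdot y,\theta_x(y))$, the pair $(S,s)$ is a solution if and only if for all $x,y,z\in S$: $(x\cdot y)\cdot z=x\cdot(y\cdot z)$, $\theta_x(y)\cdot\theta_{x\cdot y}(z)=\theta_x(y\cdot z)$, and $\theta_{\theta_x(y)}\theta_{x\cdot y}=\theta_y$. It is finite if $S$ is finite. It is commutative if $s_{12}s_{13}=s_{13}s_{12}$, equivalently $x\cdot y\cdot z=x\cdot z\cdot y$ and $\theta_{x\cdot y}=\theta_x$ for all $x,y,z\in S$. It is non-degenerate if every $\theta_x:S\to S$ is bijective. For a non-degenerate solution, $\mathcal{G}(S,s)$ is the subgroup of $\mathrm{Sym}(S)$ generated by $\{\theta_x: x\in S\}$. For a commutative non-degenerate solution, the retract relation is $x\sim y\iff\theta_x=\theta_y$; it induces a solution $\mathrm{Ret}(S,s)$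 on $S/\!\sim$ by $\bar s(\bar x,\bar y)=(\overline{x\cdot y},\overline{\theta_x(y)})$. The solution is irretractable if $(S,s)=\mathrm{Ret}(S,s)$, i.e. $\theta_x=\theta_y$ implies $x=y$. Two solutions $(S,s)$, $(T,t)$ are isomorphic if there is a bijection $\phi:S\to T$ with $(\phi\times\phi)s=t(\phi\times\phi)$. *)

(* Defs.v *)
From HB Require Import structures.
From mathcomp Require Import all_boot all_fingroup.

Set Implicit Arguments.
Unset Strict Implicit.
Unset Printing Implicit Defensive.

Section PentagonMaps.
Variables (S : Type) (s : S * S -> S * S).

Definition s12 (u : S * S * S) : S * S * S :=
  let: (x, y, z) := u in let: (a, b) := s (x, y) in (a, b, z).

Definition s23 (u : S * S * S) : S * S * S :=
  let: (x, y, z) := u in let: (b, c) := s (y, z) in (x, b, c).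

Definition tau12 (u : S * S * S) : S * S * S :=
  let: (x, y, z) := u in (y, x, z).

Definition s13 : S * S * S -> S * S * S := tau12 \o s23 \o tau12.

Definition is_solution : Prop :=
  inhabited S /\ s23 \o s13 \o s12 =1 s12 \o s23.

Definition is_commutative : Prop := s12 \o s13 =1 s13 \o s12.

Definition theta (x y : S) : S := (s (x, y)).2.

Definition non_degenerate : Prop := forall x, bijective (theta x).

(* The classes of the retract relation [theta x =1 theta y] are singletons. *)
Definition irretractable : Prop :=
  forall x y, theta x =1 theta y -> x = y.

End PentagonMaps.

Definition isomorphic (S T : Type) (s : S * S -> S * S) (t : T * T -> T * T) :=
  exists2 phi : S -> T, bijective phi &
    forall x y, (phi (s (x, y)).1, phi (s (x, y)).2) = t (phi x, phi y).

Definition group_sol (G : groupType) (u : G * G) : G * G :=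
  (u.1, (u.1^-1 * u.2)%g).

(* The group law of [{perm T}] is composition in diagrammatic order,
   (f * g) x = g (f x). [symmetric T] is the same set of permutations with the
   usual composition (f * g) x = f (g x); see [symmetricM]. *)
Definition symmetric (T : finType) : Type := {perm T}.

Section Symmetric.
Variable T : finType.

HB.instance Definition _ := Finite.on (symmetric T).

Let mul (f g : {perm T}) : symmetric T := (g * f)%g.
Let one : symmetric T := (1 : {perm T})%g.
Let inv (f : {perm T}) : symmetric T := (f^-1)%g.

Fact symmetric_mulP : associative mul.
Proof. by move=> f g h; rewrite /mul mulgA. Qed.

Fact symmetric_oneP : left_id one mul.
Proof. by move=> f; rewrite /mul mulg1. Qed.

Fact symmetric_invP : left_inverse one inv mul.
Proof. by move=> f; rewrite /mul /inv mulgV. Qed.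

HB.instance Definition _ := Finite_isGroup.Build (symmetric T)
  symmetric_mulP symmetric_oneP symmetric_invP.

Lemma symmetricM (f g : symmetric T) (x : T) :
  ((f * g)%g : {perm T}) x = (f : {perm T}) ((g : {perm T}) x).
Proof. exact: permM. Qed.

End Symmetric.

Section PermutationGroup.
Variables (S : finType) (s : S * S -> S * S) (nd : non_degenerate s).

Definition theta_perm (x : S) : symmetric S := perm (bij_inj (nd x)).

Definition perm_group : {group symmetric S} :=
  <<[set theta_perm x | x : S]>>%G.

End PermutationGroup.

(* Main.v *)
Require Import Defs.
From mathcomp Require Import all_boot all_fingroup.

(** Write [s (x, y) = (x . y, theta x y)]. The pentagon equation contains
    [theta (theta x y) \o theta (x . y) = theta y], and commutativity makes
    [theta (x . y)] equal to [theta x]. Two things follow. Irretractability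
    collapses the product to [x . y = x] (lemma [mul_fst]). And in the
    symmetric group [theta_(theta_x y) = theta_y * theta_x^-1] (lemma
    [theta_perm_theta]), so the set of all [theta_x] is non-empty and stable
    under [(h, g) |-> h * g^-1]: it is already a subgroup, and the group it
    generates contains nothing else (lemma [perm_group_imset]).

    Hence every element of the group is some [theta_x], for a single [x] by
    irretractability. Inverting the identity above gives
    [theta_(theta_x y)^-1 = (theta_x^-1)^-1 * theta_y^-1], which is the second
    component of the solution of the group at the pair
    [(theta_x^-1, theta_y^-1)]. The isomorphism is therefore
    [x |-> theta_x^-1]; the map [x |-> theta_x] would produce [h * g^-1] where
    the solution of the group has [g^-1 * h]. *)

Set Implicit Arguments.
Unset Strict Implicit.
Unset Printing Implicit Defensive.

(** Comparison of the last components of the two sides of the pentagon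
    equation at [(x, y, z)]. *)
Lemma theta_pentagon (S : Type) (s : S * S -> S * S) (x y : S) :
  is_solution s ->
  theta s (theta s x y) \o theta s (s (x, y)).1 =1 theta s y.
Proof.
move=> [_ pent] z; have := congr1 snd (pent (x, y, z)).
rewrite /= /s13 /s12 /s23 /tau12 /theta /=.
case: (s (x, y)) => a b /=; case: (s (a, z)) => c d /=.
by case: (s (b, d)) => e f /=; case: (s (y, z)) => g h /=; case: (s (x, g)).
Qed.

(** In [s12 \o s13 = s13 \o s12] only [s13] changes the last component, and it
    does so before or after [s12] has replaced [x] by [x . y]. *)
Lemma theta_mul (S : Type) (s : S * S -> S * S) (x y : S) :
  is_commutative s -> theta s (s (x, y)).1 =1 theta s x.
Proof.
move=> comm z; have := congr1 snd (comm (x, y, z)).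
rewrite /= /s13 /s12 /s23 /tau12 /theta /=.
case: (s (x, y)) => a b /=; case: (s (x, z)) => c d /=.
by case: (s (a, z)) => e f /=; case: (s (c, y)).
Qed.

Lemma mul_fst (S : Type) (s : S * S -> S * S) (x y : S) :
  is_commutative s -> irretractable s -> (s (x, y)).1 = x.
Proof. by move=> comm irr; apply: irr; exact: theta_mul. Qed.

Section ThetaGroup.
Import GroupScope.
Variables (S : finType) (s : S * S -> S * S).
Hypotheses (sol : is_solution s) (comm : is_commutative s).
Hypothesis nd : non_degenerate s.

Lemma theta_perm_theta (x y : S) :
  theta_perm nd (theta s x y) = theta_perm nd y * (theta_perm nd x)^-1.
Proof.
apply: (mulIg (theta_perm nd x)); rewrite mulgKV; apply/permP => z.
rewrite symmetricM !permE -(theta_mul x y comm z).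
exact: (theta_pentagon x y sol z).
Qed.

(** The one-step subgroup criterion: [theta_perm_theta] says that right
    quotients of [theta]'s are again [theta]'s. *)
Lemma perm_group_imset :
  perm_group nd = [set theta_perm nd x | x : S] :> {set Defs.symmetric S}.
Proof.
set T := imset _ _.
have Tdiv g h : g \in T -> h \in T -> h * g^-1 \in T.
  by case/imsetP=> x _ -> /imsetP[y _ ->]; rewrite -theta_perm_theta imset_f.
have T1 : 1 \in T.
  have [[x] _] := sol; have Tx : theta_perm nd x \in T by rewrite imset_f.
  by rewrite -(mulgV (theta_perm nd x)) Tdiv.
have Tgroup : group_set T.
  apply/group_setP; split=> // g h Tg Th.
  by rewrite -(invgK h) Tdiv // -(mul1g h^-1) Tdiv.
exact: (gen_set_id Tgroup).
Qed.

End ThetaGroup.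

Lemma theta_perm_inj (S : finType) (s : S * S -> S * S)
    (nd : non_degenerate s) :
  irretractable s -> injective (theta_perm nd).
Proof.
move=> irr x y eq_xy; apply: irr => z.
by have /permP/(_ z) := eq_xy; rewrite !permE.
Qed.

Theorem theorem20 (S : finType) (s : S * S -> S * S)
    (sol : is_solution s) (comm : is_commutative s) (nd : non_degenerate s)
    (irr : irretractable s) :
  isomorphic s (@group_sol [subg (perm_group nd)]).
Proof.
have Gtheta x : theta_perm nd x \in perm_group nd by rewrite mem_gen ?imset_f.
exists (fun x => (subg (perm_group nd) (theta_perm nd x))^-1%g).
  apply: inj_card_bij => [x y /invg_inj eq_xy | ].
    apply: (theta_perm_inj irr).
    by rewrite -(subgK _ (Gtheta x)) -(subgK _ (Gtheta y)) eq_xy.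
  (* Surjectivity follows by counting, as the group consists of the maps
     [theta_x] alone. *)
  by rewrite card_sub perm_group_imset // leq_imset_card.
move=> x y; rewrite mul_fst // /group_sol /= -/(theta s x y) invgK.
by rewrite theta_perm_theta // morphM ?groupV ?Gtheta // invMg morphV ?invgK.
Qed.
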